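(* Let $k$ and $j$ be positive integers. For every graph $G$, every resolving set $S$ of $G$ with $|S|=k$, and every $v\in S$, the number of vertices $u\ne v$ with $\textnormal{dist}(u,v)=j$ is at most $(2j+1)^{k-1}$; moreover, there exist a graph $G$, a resolving set $S$ of $G$ with $|S|=k$, and $v\in S$ for which this number equals $(2j+1)^{k-1}$.
   Context: Graphs are finite, simple, undirected, possibly disconnected; $\textnormal{dist}(u,v)=\infty$ between different components. A set $S=\{v_1,\dots,v_k\}$ of vertices is a resolving set of $G$ if the vectors $(\textnormal{dist}(u,v_1),\dots,\textnormal{dist}(u,v_k))$ are pairwise distinct over $u\in V(G)$. *)

(* Defs.v *)
From mathcomp Require Import all_boot.

Set Implicit Arguments.
Unset Strict Implicit.
Unset Printing Implicit Defensive.

Record sgraph := SGraph {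
  vertex :> finType;
  adj : rel vertex;
  adj_sym : symmetric adj;
  adj_irrefl : irreflexive adj
}.

Section Distance.
Variable G : sgraph.

Definition has_walk (u v : G) (n : nat) : bool :=
  [exists p : n.-tuple G, path (@adj G) u p && (last u p == v)].

Lemma connect_has_walk (u v : G) :
  connect (@adj G) u v -> exists n, has_walk u v n.
Proof.
case/connectP=> p pth ->; exists (size p); apply/existsP.
by exists (in_tuple p); rewrite pth eqxx.
Qed.

(* [None] is the infinite distance between different components. *)
Definition dist (u v : G) : option nat :=
  if decP (@idP (connect (@adj G) u v)) is left uv
  then Some (ex_minn (connect_has_walk uv)) else None.

Lemma dist_SomeP (u v : G) (n : nat) :
  dist u v = Some n <->
  has_walk u v n /\ (forall m, has_walk u v m -> n <= m).
Proof.
rewrite /dist; split.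
  case: decP => // uv; case: ex_minnP => m wm minm [<-]; by split.
case=> wn minn; case: decP => [uv|nuv].
  case: ex_minnP => m wm minm; congr Some; apply/eqP.
  by rewrite eqn_leq minm //= minn.
case: nuv; case/existsP: wn => p /andP[pth /eqP lst].
by apply/connectP; exists p.
Qed.

Lemma dist_NoneP (u v : G) : dist u v = None <-> ~~ connect (@adj G) u v.
Proof. by rewrite /dist; case: decP => [uv|/negP]; split=> //; rewrite uv. Qed.

Definition resolving (S : {set G}) : Prop :=
  injective (fun u : G => [seq dist u v | v in S]).

End Distance.

(* Main.v *)
(** Upper bound: by the triangle inequality, a vertex at distance [j] from [v]
    has a distance to each of the other [k - 1] landmarks [w] lying in the
    interval of radius [j] around [dist v w], or infinite if that one is.

    Sharpness: take as vertices all tuples of potential distances to [k]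
    landmarks lying at mutual distance [D = 2j], that is, all tuples [u] with
    [|u_i - u_l| <= D <= u_i + u_l], and join tuples whose entries differ by at
    most 1. The landmark [s_i] is the tuple with entry 0 at [i] and [D]
    elsewhere. Moving every other entry towards [D] while decreasing [u_i] stays
    within the vertex set, so [u_i] is really the distance from [u] to [s_i].
    All tuples with [u_0 = j] and other entries in [[j, 3j]] are vertices. *)
Require Import Defs.
From mathcomp Require Import all_boot.
From mathcomp Require Import zify.

Set Implicit Arguments.
Unset Strict Implicit.
Unset Printing Implicit Defensive.

(** * Walks, distances and the upper bound *)

Section Walks.
Variable G : sgraph.
Implicit Types u v w s : G.

Lemma has_walkP u v n :
  reflect (exists p, [/\ size p = n, path (@adj G) u p & last u p = v])
          (has_walk u v n).
Proof.
apply: (iffP existsP) => [[p /andP[pth /eqP lst]]|[p [sz pth lst]]].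
  by exists p; rewrite size_tuple.
by move/eqP: sz => sz; exists (Tuple sz); rewrite /= pth lst eqxx.
Qed.

Lemma has_walk_cat u v w m n :
  has_walk u v m -> has_walk v w n -> has_walk u w (m + n).
Proof.
case/has_walkP=> p [<- pthp lstp] /has_walkP[q [<- pthq lstq]].
by apply/has_walkP; exists (p ++ q); rewrite size_cat cat_path last_cat lstp pthp.
Qed.

Lemma has_walk_sym u v n : has_walk u v n -> has_walk v u n.
Proof.
case/has_walkP=> p [<- pth <-]; apply/has_walkP; exists (rev (belast u p)).
rewrite size_rev size_belast rev_path; split=> //.
  by rewrite (eq_path (e' := @adj G)) // => x y; rewrite adj_sym.
by case: p {pth} => //= x p; rewrite rev_cons last_rcons.
Qed.

Lemma dist_sym u v : dist u v = dist v u.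
Proof.
have half (x y : G) n : dist x y = Some n -> dist y x = Some n.
  case/dist_SomeP=> wlk le_wlk; apply/dist_SomeP; split; first exact: has_walk_sym wlk.
  by move=> m /has_walk_sym/le_wlk.
case E: (dist u v) => [n|]; first by rewrite (half _ _ _ E).
by case F: (dist v u) => [n|] //; rewrite (half _ _ _ F) in E.
Qed.

Lemma has_walk_dist u v n : has_walk u v n -> exists2 d, dist u v = Some d & d <= n.
Proof.
move=> wlk; case E: (dist u v) => [d|].
  by exists d => //; case/dist_SomeP: E => _; apply.
case/dist_NoneP/negP: E; case/has_walkP: wlk => p [_ pth <-].
by apply/connectP; exists p.
Qed.

Lemma dist_triangle u v w m n : dist u v = Some m -> dist v w = Some n ->
  exists2 d, dist u w = Some d & d <= m + n.
Proof.
move=> /dist_SomeP[wm _] /dist_SomeP[wn _].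
exact: has_walk_dist (has_walk_cat wm wn).
Qed.

(** Each step of a walk lowers [f] by at most 1, so a walk from [u] to [s] has at least [f u] steps.
    Repeated use of the descent hypothesis gives one with exactly [f u] steps, which ends at [s],
    the only zero of [f]. *)
Lemma dist_potential (f : G -> nat) s :
    f s = 0 -> (forall u, f u = 0 -> u = s) ->
    (forall u w, adj u w -> f u <= (f w).+1) ->
    (forall u, 0 < f u -> exists2 w, adj u w & f w = (f u).-1) ->
  forall u, dist u s = Some (f u).
Proof.
move=> fs0 f0s flip fdec u; apply/dist_SomeP; split.
  move: {2}(f u) (erefl (f u)) => n; elim: n u => [|n IHn] u fu; rewrite fu.
    by rewrite (f0s u fu); apply/has_walkP; exists [::].
  have [|w uw fw] := fdec u; first by rewrite fu.
  rewrite fu in fw; have := IHn w fw; rewrite fw => /has_walkP[p [sz pth lst]].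
  by apply/has_walkP; exists (w :: p); rewrite /= sz uw.
move=> m /has_walkP[p [<-]]; elim: p u => [|w p IHp] u /=; first by move=> _ ->; rewrite fs0.
by case/andP=> /flip uw pth /(IHp _ pth) le_w; apply: leq_trans uw _.
Qed.

Lemma card_sphere_resolving (S : {set G}) v j : resolving S -> v \in S ->
  #|[set u | dist u v == Some j]| <= (2 * j + 1) ^ (#|S| - 1).
Proof.
move=> resS vS; set U := [set u | _].
pose d u w := odflt 0 (dist u w).
(* The shift sends the window of radius [j] around [d v w] onto [0..2j]; adding [j] before
   subtracting avoids truncation. *)
pose g u := [ffun w : {w | w \in S :\ v} =>
  inord (d u (val w) + j - d v (val w)) : 'I_(2 * j).+1].
have injg : {in U &, injective g}.
  move=> x y; rewrite !inE => /eqP dx /eqP dy eq_g.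
  apply: resS; apply/eq_in_map => w; rewrite mem_enum => wS.
  have [->|neq_wv] := eqVneq w v; first by rewrite dx dy.
  have wSv : w \in S :\ v by rewrite !inE neq_wv.
  move/ffunP/(_ (Sub w wSv)): eq_g; rewrite !ffunE SubK /d.
  (* On the sphere, whether [dist z w] is finite depends only on [w], so the default 0 in [d] never
     merges an infinite distance with a finite one. *)
  have near z : dist z v = Some j ->
      if dist v w is Some b then
        exists a, [/\ dist z w = Some a, b <= a + j & a <= b + j]
      else dist z w = None.
    move=> dz; case E: (dist v w) => [b|].
      have [a da le_a] := dist_triangle dz E.
      have dvz : dist v z = Some j by rewrite dist_sym.
      have [b'] := dist_triangle dvz da.
      by rewrite E => -[<-] le_b; exists a; split=> //; lia.
    case F: (dist z w) => [a|] //.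
    have dvz : dist v z = Some j by rewrite dist_sym.
    by have [b'] := dist_triangle dvz F; rewrite E.
  move: (near x dx) (near y dy); case: (dist v w) => [b|-> ->] //.
  move=> [a [-> ? ?]] [a' [-> ? ?]] /= /(congr1 val) /=.
  by rewrite !inordK; [move=> ?; congr Some| |]; lia.
rewrite -(card_in_imset injg); apply: leq_trans (max_card _) _.
rewrite card_ffun card_ord card_sig -addn1.
by rewrite [#|[pred w | _]|](_ : _ = #|S| - 1) // (cardsD1 v S) vS add1n subn1.
Qed.

End Walks.

(** * The extremal graph of distance tuples *)

Section Extremal.
Variables (k j : nat).
Local Notation D := (2 * j).

Definition admissible (u : 'I_k -> nat) :=
  [forall i, forall l, (i != l) ==> (u i <= u l + D) && (D <= u i + u l)].

Lemma admissibleP (u : 'I_k -> nat) :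
  reflect (forall i l, i != l -> u i <= u l + D /\ D <= u i + u l) (admissible u).
Proof.
apply: (iffP forallP) => [adm i l il|adm i].
  by have /forallP/(_ l) := adm i; rewrite il => /andP.
by apply/forallP => l; apply/implyP => il; apply/andP/adm.
Qed.

(** The cap [3 * j] makes the type finite. It equals [D + j], the largest entry possible beside an
    entry [j]. *)
Definition profile := {u : {ffun 'I_k -> 'I_(3 * j).+1} | admissible (fun i => u i)}.

Definition coord (u : profile) (i : 'I_k) : nat := val u i.

Lemma coord_le u i : coord u i <= 3 * j.
Proof. by rewrite -ltnS /coord. Qed.

Lemma coord_admissible u : admissible (coord u).
Proof. exact: valP u. Qed.

Lemma coord_inj (u w : profile) : coord u =1 coord w -> u = w.
Proof. by move=> uw; apply/val_inj/ffunP => i; apply/val_inj/uw. Qed.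

Lemma profile_of (f : 'I_k -> nat) :
  (forall i, f i <= 3 * j) -> admissible f -> exists u : profile, coord u =1 f.
Proof.
move=> f_le adm; pose g := [ffun i => inord (f i) : 'I_(3 * j).+1].
have gE i : g i = f i :> nat by rewrite ffunE inordK ?ltnS.
have admg : admissible (fun i => g i).
  by apply/admissibleP => i l il; rewrite !gE; apply: (admissibleP _ adm).
by exists (Sub g admg) => i; rewrite /coord SubK.
Qed.

Definition padj : rel profile := fun u w =>
  (u != w) && [forall i, (coord u i <= (coord w i).+1) && (coord w i <= (coord u i).+1)].

Lemma padj_sym : symmetric padj.
Proof.
by move=> u w; rewrite /padj eq_sym; congr (_ && _); apply: eq_forallb => i; rewrite andbC.
Qed.

Lemma padj_irrefl : irreflexive padj.
Proof. by move=> u; rewrite /padj eqxx. Qed.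

Definition profile_graph : sgraph := SGraph padj_sym padj_irrefl.

Definition toward (x : nat) := if D < x then x.-1 else if x < D then x.+1 else x.

(** Away from [i], [toward] is monotone and 1-Lipschitz, so differences do not grow; a sum drops
    only if some entry exceeds [D], and that entry stays at least [D]. Against entry [i], an entry
    below [D] rises and preserves the sum, one above [D] falls together with entry [i], and one
    equal to [D] stays. *)
Lemma coord_decr (u : profile) i : 0 < coord u i ->
  exists2 w, padj u w & coord w i = (coord u i).-1.
Proof.
move=> ui_gt0; have adm := admissibleP _ (coord_admissible u).
pose f l := if l == i then (coord u i).-1 else toward (coord u l).
have [||w wf] := @profile_of f.
- move=> l; rewrite /f /toward.
  have := coord_le u l; have := coord_le u i.
  by case: eqP => _; case: (ltngtP D (coord u l)) => ?; lia.
- apply/admissibleP => l m lm; rewrite /f /toward.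
  have := adm l m lm; have := adm m l; rewrite eq_sym lm => /(_ isT).
  case: (eqVneq l i) lm => [->|_]; case: (eqVneq m i) => [->|_]; rewrite ?eqxx // => _;
    by case: (ltngtP D (coord u l)) => ?; case: (ltngtP D (coord u m)) => ?; lia.
exists w; last by rewrite wf /f eqxx.
apply/andP; split.
  by apply/eqP => uw; have := wf i; rewrite -uw /f eqxx; lia.
apply/forallP => l; rewrite wf /f /toward.
by case: eqVneq => [->|_]; case: (ltngtP D (coord u l)) => ?; lia.
Qed.

Lemma landmark_ex i : exists u : profile, coord u =1 (fun l => if l == i then 0 else D).
Proof.
apply: profile_of => [l|]; first by case: ifP => _; lia.
apply/admissibleP => l m lm /=.
by case: (eqVneq l i) lm => [->|_]; case: (eqVneq m i) => // _ _; lia.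
Qed.

Lemma landmark_sig i :
  {u : profile | [forall l, coord u l == if l == i then 0 else D]}.
Proof. by apply: sigW; have [u uE] := landmark_ex i; exists u; apply/forallP => l; rewrite uE. Qed.

Definition landmark i : profile := sval (landmark_sig i).

Lemma coord_landmark i l : coord (landmark i) l = if l == i then 0 else D.
Proof. by apply/eqP; move: l; apply/forallP; apply: svalP (landmark_sig i). Qed.

Hypothesis j_gt0 : 0 < j.

Lemma landmark_inj : injective landmark.
Proof.
move=> i l /(congr1 (fun u => coord u i)); rewrite !coord_landmark eqxx.
by case: eqP => // _; lia.
Qed.

(** A zero at [i] turns the two admissibility inequalities into [coord u l <= D] and
    [D <= coord u l]. *)
Lemma coord_eq0 (u : profile) i : coord u i = 0 -> u = landmark i.
Proof.
move=> ui0; apply: coord_inj => l; rewrite coord_landmark.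
case: eqVneq => [->//|li].
by have [] := admissibleP _ (coord_admissible u) l i li; lia.
Qed.

Lemma dist_landmark (u : profile_graph) i : @dist profile_graph u (landmark i) = Some (coord u i).
Proof.
move: u; apply: (@dist_potential profile_graph (coord^~ i)).
- by rewrite coord_landmark eqxx.
- by move=> u /coord_eq0.
- by move=> u w /andP[_ /forallP/(_ i)/andP[]].
- by move=> u; apply: coord_decr.
Qed.

Definition landmarks : {set profile_graph} := [set landmark i | i : 'I_k].

Lemma card_landmarks : #|landmarks| = k.
Proof. by rewrite card_imset ?card_ord //; apply: landmark_inj. Qed.

Lemma resolving_landmarks : resolving landmarks.
Proof.
move=> u w /eq_in_map uw; apply: coord_inj => i.
apply: Some_inj; rewrite -!dist_landmark; apply: uw.
by rewrite mem_enum imset_f.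
Qed.

End Extremal.

(** * Counting the sphere in the extremal graph, and the conclusion *)

Lemma card_coord_eq (k j : nat) :
  (2 * j + 1) ^ k <= #|[set u : profile k.+1 j | coord u ord0 == j]|.
Proof.
(* Entry [ord0] is fixed to [j]; [h] freely chooses the offsets above [j] of the other [k] entries.
   Any two numbers between [j] and [3j] differ by at most [2j] and sum to at least [2j]. *)
pose f (h : {ffun 'I_k -> 'I_(2 * j).+1}) i :=
  if unlift ord0 i is Some l then j + h l else j.
have f_ex h : exists u : profile k.+1 j, [forall i, coord u i == f h i].
  suff [u uE] : exists u : profile k.+1 j, coord u =1 f h.
    by exists u; apply/forallP => i; rewrite uE.
  apply: profile_of => [i|].
    by rewrite /f; case: unliftP => [l _|_]; [have := ltn_ord (h l)|]; lia.
  apply/admissibleP => i l; rewrite /f.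
  case: unliftP => [i'|] ->; case: unliftP => [l'|] ->; rewrite ?eqxx // => _.
  - by have := ltn_ord (h i'); have := ltn_ord (h l'); lia.
  - by have := ltn_ord (h i'); lia.
  - by have := ltn_ord (h l'); lia.
pose g h := xchoose (f_ex h).
have gE h i : coord (g h) i = f h i.
  by apply/eqP; move: i; apply/forallP; apply: xchooseP (f_ex h).
have injg : injective g.
  move=> h h' eq_g; apply/ffunP => l; apply/val_inj/(@addnI j).
  have := gE h (lift ord0 l); rewrite eq_g gE.
  by rewrite /f liftK.
have -> : (2 * j + 1) ^ k = #|g @: setT|.
  by rewrite card_imset // cardsT card_ffun !card_ord addn1.
apply/subset_leq_card/subsetP => _ /imsetP[h _ ->].
by rewrite inE gE /f unlift_none.
Qed.

Theorem theorem29 (k j : nat) (hk : 0 < k) (hj : 0 < j) :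
  (forall (G : sgraph) (S : {set G}), resolving S -> #|S| = k ->
   forall v : G, v \in S ->
     #|[set u : G | (u != v) && (dist u v == Some j)]| <= (2 * j + 1) ^ (k - 1))
  /\
  (exists (G : sgraph) (S : {set G}) (v : G),
     [/\ resolving S, #|S| = k, v \in S &
         #|[set u : G | (u != v) && (dist u v == Some j)]|
           = (2 * j + 1) ^ (k - 1)]).
Proof.
have upper (G : sgraph) (S : {set G}) (resS : resolving S) (cardS : #|S| = k)
    (v : G) (vS : v \in S) :
    #|[set u : G | (u != v) && (dist u v == Some j)]| <= (2 * j + 1) ^ (k - 1).
  rewrite -cardS; apply: leq_trans (card_sphere_resolving j resS vS).
  by apply/subset_leq_card/subsetP => u; rewrite !inE => /andP[].
split=> //; case: k hk upper => // k _ upper.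
have resS := @resolving_landmarks k.+1 j hj.
have cardS := @card_landmarks k.+1 j hj.
have vS : landmark j ord0 \in landmarks k.+1 j by rewrite imset_f.
exists (profile_graph k.+1 j), (landmarks k.+1 j), (landmark j ord0); split=> //.
(* The general upper bound gives one inequality, so only the lower bound remains. *)
apply/eqP; rewrite eqn_leq (upper _ _ resS cardS _ vS) subn1 /=.
apply: leq_trans (card_coord_eq k j) _.
apply/subset_leq_card/subsetP => u; rewrite !inE => /eqP uj.
rewrite dist_landmark // uj eqxx andbT.
(* The landmark has entry 0 at [ord0], whereas [u] has [j > 0] there. *)
by apply/eqP => ul; move: uj; rewrite ul coord_landmark eqxx; lia.
Qed.
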